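(* Let $B^k$ be the set of $d$ row indices used at the $k$-th iteration of the facet pivot simplex method for a linear program in standard general form, and let $B^{k+1}=(B^k\cup\{p\})\setminus\{q\}$ be obtained from it by a facet pivot step with entering row $a_p$ and leaving row $a_q$ (see context). If the rows of $A_{B^k}$ are linearly independent, then the rows of $A_{B^{k+1}}$ are linearly independent.
   Context: Standard general form LP: let $A^I\in\mathbb{R}^{m\times d}$, $A^J\in\mathbb{R}^{n\times d}$, let $E\in\mathbb{R}^{d\times d}$ be diagonal with diagonal entries in $\{1,-1\}$, $F=-E$, and let $b^I\in\mathbb{R}^m$, $b^J\in\mathbb{R}^n$, $b_L,b_U\in\mathbb{R}^d$. Let $\bar c\in\mathbb{R}^d$ with $\bar c\ge 0$ and $c=E^{T}\bar c$. The problem is to minimize $c^{T}x$ subject to $A^I x=b^I$, $A^J x\ge b^J$, $Ex\ge b_L$, $Fx\ge b_U$ (componentwise). Stack the constraints as $A=(A^I,A^J,E,F)\in\mathbb{R}^{(m+n+2d)\times d}$ and $b=(b^I,b^J,b_L,b_U)$, with rows $a_i$ (row vectors) and entries $b_i$. $\mathcal{E}=\{1,\dots,m\}$ is the index set of equality constraints and $\mathcal{I}=\{m+1,\dots,m+n+2d\}$ that of inequality constraints. Standing assumptions: $\operatorname{rank}(A^I)<d$ and $\operatorname{rank}(A)=d$. For an index set $B$, $A_B$ and $b_B$ denote the submatrix of $A$ and the subvector of $b$ with indices in $B$. Facet pivot step (for $B^k$ of size $d$ with linearly independent rows): let $x^k$ solve $A_{B^k}x^k=b_{B^k}$, let $\mathcal{I}_0=B^k\cap\mathcal{I}$,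 and write $c=\sum_{j\in B^k}y_{cj}^k a_j^{T}$, where the method maintains $y_{cj}^k\ge 0$ for $j\in\mathcal{I}_0$. Choose an entering index $p\notin B^k$ whose constraint is violated at $x^k$, and write $a_p^{T}=\sum_{j\in B^k}y_{pj}^k a_j^{T}$. The leaving index $q\in\mathcal{I}_0$ is chosen as follows. Case 1: $a_p x^k<b_p$ (with $p\in\mathcal{I}\cup\mathcal{E}$) and $y_{pj}^k>0$ for at least one $j\in\mathcal{I}_0$. Then $q\in\mathcal{I}_0$ satisfies $y_{pq}^k>0$ and $\frac{y_{cq}^k}{y_{pq}^k}=\min\{\frac{y_{cj}^k}{y_{pj}^k} : y_{pj}^k>0,\ j\in\mathcal{I}_0\}$. Case 2: $a_p x^k>b_p$ with $p\in\mathcal{E}$, and $y_{pj}^k<0$ for at least one $j\in\mathcal{I}_0$. Then $q\in\mathcal{I}_0$ satisfies $y_{pq}^k<0$ and $\frac{y_{cq}^k}{y_{pq}^k}=\max\{\frac{y_{cj}^k}{y_{pj}^k} : y_{pj}^k<0,\ j\in\mathcal{I}_0\}$. The new index set is $B^{k+1}=(B^k\cup\{p\})\setminus\{q\}$. *)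

(* Defs.v *)
From HB Require Import structures.
From mathcomp Require Import all_boot all_order all_algebra.

Set Implicit Arguments.
Unset Strict Implicit.
Unset Printing Implicit Defensive.

Import Order.TTheory GRing.Theory Num.Theory.
Local Open Scope ring_scope.

(* min c^T x  s.t.  AI x = bI, AJ x >= bJ, E x >= bL, -E x >= bU,
   where c = E^T cbar. *)
Record general_lp (R : realFieldType) (m n d : nat) := GeneralLP {
  lp_AI : 'M[R]_(m, d);
  lp_AJ : 'M[R]_(n, d);
  lp_E : 'M[R]_d;
  lp_bI : 'cV[R]_m;
  lp_bJ : 'cV[R]_n;
  lp_bL : 'cV[R]_d;
  lp_bU : 'cV[R]_d;
  lp_cbar : 'cV[R]_d;
  lp_E_diag : is_diag_mx lp_E;
  lp_E_sign : forall i, lp_E i i = 1 \/ lp_E i i = -1;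
  lp_cbar_ge0 : forall i, 0 <= lp_cbar i 0;
}.

Section GeneralLP.
Context {R : realFieldType} {m n d : nat}.
Variable P : general_lp R m n d.

Definition lp_F : 'M[R]_d := - lp_E P.

Definition lp_c : 'cV[R]_d := (lp_E P)^T *m lp_cbar P.

Definition lp_A : 'M[R]_(m + n + (d + d), d) :=
  col_mx (col_mx (lp_AI P) (lp_AJ P)) (col_mx (lp_E P) lp_F).

Definition lp_b : 'cV[R]_(m + n + (d + d)) :=
  col_mx (col_mx (lp_bI P) (lp_bJ P)) (col_mx (lp_bL P) (lp_bU P)).

Definition standing_assumptions : Prop :=
  (\rank (lp_AI P) < d)%N /\ \rank lp_A = d.

(* Rows are indexed from 0, so the equality constraints are those below m. *)
Definition eq_idx : {set 'I_(m + n + (d + d))} := [set i : 'I_(m + n + (d + d)) | (i < m)%N].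
Definition ineq_idx : {set 'I_(m + n + (d + d))} := [set i : 'I_(m + n + (d + d)) | (m <= i)%N].

(* Rows are listed in the increasing order of their indices. *)
Definition lp_A_sub (B : {set 'I_(m + n + (d + d))}) : 'M[R]_(#|B|, d) :=
  rowsub (@enum_val _ (mem B)) lp_A.
Definition lp_b_sub (B : {set 'I_(m + n + (d + d))}) : 'cV[R]_#|B| :=
  rowsub (@enum_val _ (mem B)) lp_b.

Definition lhs (x : 'cV[R]_d) (i : 'I_(m + n + (d + d))) : R :=
  (lp_A *m x) i 0.

Definition constraint_holds (x : 'cV[R]_d) (i : 'I_(m + n + (d + d))) : bool :=
  if i \in eq_idx then lhs x i == lp_b i 0 else lp_b i 0 <= lhs x i.

(* Only the values of y on B matter. *)
Definition row_coords (B : {set 'I_(m + n + (d + d))})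
    (v : 'cV[R]_d) (y : 'I_(m + n + (d + d)) -> R) : Prop :=
  v = \sum_(j in B) y j *: (row j lp_A)^T.

Definition pivot_case1 (I0 : {set 'I_(m + n + (d + d))}) (x : 'cV[R]_d)
    (yc yp : 'I_(m + n + (d + d)) -> R) (p q : 'I_(m + n + (d + d))) : Prop :=
  [/\ lhs x p < lp_b p 0,
      exists2 j, j \in I0 & 0 < yp j,
      0 < yp q &
      forall j, j \in I0 -> 0 < yp j -> yc q / yp q <= yc j / yp j].

Definition pivot_case2 (I0 : {set 'I_(m + n + (d + d))}) (x : 'cV[R]_d)
    (yc yp : 'I_(m + n + (d + d)) -> R) (p q : 'I_(m + n + (d + d))) : Prop :=
  [/\ p \in eq_idx /\ lp_b p 0 < lhs x p,
      exists2 j, j \in I0 & yp j < 0,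
      yp q < 0 &
      forall j, j \in I0 -> yp j < 0 -> yc j / yp j <= yc q / yp q].

(* For #|B| = d and A_B with independent rows, step_x, step_yc and step_yp
   determine x and the values of yc and yp on B. *)
Record facet_pivot_step (B : {set 'I_(m + n + (d + d))}) (x : 'cV[R]_d)
    (yc yp : 'I_(m + n + (d + d)) -> R) (p q : 'I_(m + n + (d + d))) : Prop :=
  FacetPivotStep {
  step_x : lp_A_sub B *m x = lp_b_sub B;
  step_yc : row_coords B lp_c yc;
  step_yc_ge0 : forall j, j \in B :&: ineq_idx -> 0 <= yc j;
  step_p : p \notin B /\ ~~ constraint_holds x p;
  step_yp : row_coords B (row p lp_A)^T yp;
  step_q : q \in B :&: ineq_idx;
  step_ratio : pivot_case1 (B :&: ineq_idx) x yc yp p q \/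
               pivot_case2 (B :&: ineq_idx) x yc yp p q;
}.

End GeneralLP.

(* Main.v *)
(** The pivot rule only selects q with y_pq <> 0, so a_q is a combination of
    a_p and the other rows of A_B.  Hence the row space of the new submatrix
    contains that of A_B, so its rank is at least |B|, its number of rows. *)
Require Import Defs.
From HB Require Import structures.
From mathcomp Require Import all_boot all_order all_algebra.

Set Implicit Arguments.
Unset Strict Implicit.
Unset Printing Implicit Defensive.

Import Order.TTheory GRing.Theory Num.Theory.
Local Open Scope ring_scope.

Lemma row_sub_rowsub_enum (F : fieldType) (k d : nat) (A : 'M[F]_(k, d))
    (B : {set 'I_k}) (i : 'I_k) :
  i \in B -> (row i A <= rowsub (@enum_val _ (mem B)) A)%MS.
Proof.
move=> iB; have -> : row i A = row (enum_rank_in iB i) (rowsub (@enum_val _ (mem B)) A).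
  by apply/rowP => j; rewrite !mxE enum_rankK_in.
exact: row_sub.
Qed.

(** Steinitz exchange over any field: the linear program enters only through a nonzero coefficient
    [y q]. *)
Lemma row_free_exchange (F : fieldType) (k d : nat) (A : 'M[F]_(k, d))
    (B : {set 'I_k}) (y : 'I_k -> F) (p q : 'I_k) :
  p \notin B -> q \in B -> y q != 0 ->
  row p A = \sum_(j in B) y j *: row j A ->
  row_free (rowsub (@enum_val _ (mem B)) A) ->
  row_free (rowsub (@enum_val _ (mem ((p |: B) :\ q))) A).
Proof.
move=> pB qB yq0 rpE freeB; set B' := (p |: B) :\ q.
have pq : p != q by apply: contraNneq pB => ->.
have cardB' : #|B'| = #|B|.
  (* Both [B] and [B'] are one element short of [p |: B]. *)
  have := cardsD1 q (p |: B); rewrite cardsU1 pB in_setU1 qB orbT.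
  by case.
have in_span i : i \in B' -> (row i A <= rowsub (@enum_val _ (mem B')) A)%MS.
  exact: row_sub_rowsub_enum.
have q_span : (row q A <= rowsub (@enum_val _ (mem B')) A)%MS.
  (* Solve [rpE] for its [j = q] term; every row left on the right is indexed in [B'], with [pq]
     ensuring that [p] survives the removal of [q]. *)
  have -> : row q A =
      (y q)^-1 *: (row p A - \sum_(j in B | j != q) y j *: row j A).
    by rewrite rpE (bigD1 q) //= addrK scalerA mulVf ?scale1r.
  apply/scalemx_sub/addmx_sub; first by rewrite in_span // !inE pq eqxx.
  rewrite eqmx_opp; apply: summx_sub => j /andP[jB jq].
  by apply/scalemx_sub/in_span; rewrite !inE jq jB orbT.
(* Rank is monotone in the row space and bounded by the number of rows, here [#|B'| = #|B|]. *)
suff sBB' : (rowsub (@enum_val _ (mem B)) A <= rowsub (@enum_val _ (mem B')) A)%MS.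
  rewrite /row_free eqn_leq rank_leq_row /=.
  by apply: leq_trans (mxrankS sBB'); rewrite (eqP freeB) cardB'.
apply/row_subP => i; rewrite row_rowsub.
have iB := enum_valP i.
have [-> //|iq] := eqVneq (enum_val i) q.
by apply: in_span; rewrite !inE iq iB orbT.
Qed.

Theorem theorem4p5 (R : realFieldType) (m n d : nat) (P : general_lp R m n d)
    (hP : standing_assumptions P)
    (B : {set 'I_(m + n + (d + d))}) (x : 'cV[R]_d)
    (yc yp : 'I_(m + n + (d + d)) -> R) (p q : 'I_(m + n + (d + d)))
    (hcard : #|B| = d)
    (hstep : facet_pivot_step P B x yc yp p q)
    (hfree : row_free (lp_A_sub P B)) :
  row_free (lp_A_sub P ((p |: B) :\ q)).
Proof.
case: hstep => _ _ _ [pB _] ypE /setIP[qB _] ratio.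
apply: (row_free_exchange (y := yp)) => //.
  (* Each case of the rule fixes a strict sign for [yp q]. *)
  by case: ratio => -[_ _ yq _]; rewrite ?(gt_eqF yq) ?(lt_eqF yq).
(* [row_coords] is an identity of columns; transposing gives the one between rows. *)
rewrite -[LHS]trmxK ypE raddf_sum; apply: eq_bigr => j _.
by rewrite /= linearZ /= trmxK.
Qed.
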